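(* Consider a single signal source whose propagation field $\rho:\mathcal D\to\mathbb R$ is a deterministic third-order differentiable function on a bounded area $\mathcal D\subseteq\mathbb R^2$, and suppose that each of $M$ sensors at known locations $\bm z_1,\dots,\bm z_M\in\mathcal D$ measures all $K$ frequency bands, $$\gamma_m^{(k)}=\rho(\bm z_m)\phi_k+\eta_{m,k}\,\phi_k+\epsilon_{m,k},\qquad m=1,\dots,M,\ k=1,\dots,K,$$ where the power spectrum $\bm\Phi=(\phi_1,\dots,\phi_K)$ is known, with $\phi_k\ge 0$ and $\sum_{k=1}^K\phi_k=K$, and where all $\eta_{m,k}\sim\mathcal N(0,\sigma_\eta^2)$ and $\epsilon_{m,k}\sim\mathcal N(0,\sigma_\epsilon^2)$ are mutually independent. Let $\bm c_{ij}\in\mathcal D$ and let $\hat\alpha_{ij}$ be the coefficient $\alpha$ of a minimizer $(\alpha,\bm\beta,\bm B)\in\mathbb R\times\mathbb R^2\times\mathbb R^{2\times2}$ of $$\sum_{m=1}^M\sum_{k=1}^K\Big(\gamma_m^{(k)}-\phi_k\big[\alpha+\bm\beta^{\mathrm T}(\bm z_m-\bm c_{ij})+(\bm z_m-\bm c_{ij})^{\mathrm T}\bm B(\bm z_m-\bm c_{ij})\big]\Big)^2\kappa\Big(\frac{\bm z_m-\bm c_{ij}}{b}\Big).$$ Then the variance $\mathcal E_{\mathrm t}=\mathbb V\{\xi_{ij}\}$ of the interpolation error $\xi_{ij}=\hat\alpha_{ij}-\rho(\bm c_{ij})$ is $$\mathcal E_{\mathrm t}=\left(\frac{\sum_{k=1}^K\phi_k^4}{\big(\sum_{k=1}^K\phi_k^2\big)^2}\,\sigma_\eta^2+\frac{1}{\sum_{k=1}^K\phi_k^2}\,\sigma_\epsilon^2\right)C(\{\bm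 z_m\},b),$$ where $C(\{\bm z_m\},b)$ is a constant depending only on the sensor locations $\{\bm z_m\}$ and the window size $b$ (for the given point $\bm c_{ij}$ and kernel $\kappa$), and in particular not on $K$, $\bm\Phi$, $\rho$, $\sigma_\eta^2$, $\sigma_\epsilon^2$.
   Context: $\kappa:\mathbb R^2\to[0,\infty)$ is a fixed kernel function (for example the Epanechnikov kernel $\kappa(\bm u)=\max\{0,\tfrac34(1-\|\bm u\|^2)\}$) and $b>0$ is the window size. $\mathbb V\{\cdot\}$ denotes variance. Standing assumption: the sensor configuration around $\bm c_{ij}$ is non-degenerate, in the sense that the coefficient $\alpha$ is the same for all minimizers of the weighted least-squares problem, so that $\hat\alpha_{ij}$ is well defined (the matrix $\bm B$ itself matters only through its symmetric part). *)

(* Defs.v *)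
(* MathComp / MathComp-Analysis *)
From HB Require Import structures.
From mathcomp Require Import all_boot all_order all_algebra.
From mathcomp Require Import all_classical all_reals all_analysis.
Set Implicit Arguments.
Unset Strict Implicit.
Unset Printing Implicit Defensive.
Import Order.TTheory GRing.Theory Num.Theory.
Import numFieldNormedType.Exports.
Local Open Scope classical_set_scope.
Local Open Scope ring_scope.

(* [f] is n times (Frechet) differentiable on [D], relative to [D]: only the
   values of [f] on [D] matter, so that [f] stands for a function defined on
   [D] only, and [D] need not be open.  [grad x] is the gradient at [x], and
   its two components are required to be n-1 times differentiable.  At interior
   points of [D] the first-order condition is the usual differentiability. *)
Fixpoint differentiable_on (R : realType) (n : nat) (D : set 'cV[R]_2)
    (f : 'cV[R]_2 -> R) : Prop :=
  if n is n'.+1 then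
    exists grad : 'cV[R]_2 -> 'cV[R]_2,
      (forall x, D x -> forall y,
         (f y - f x - ((grad x)^T *m (y - x)) 0 0 : R^o)
           =o_(y \near within D (nbhs x)) (y - x)) /\
      (forall i : 'I_2, differentiable_on n' D (fun x => grad x i 0))
  else True.

(* The law N(0, s^2).  [normal_prob] is not the Dirac mass when s = 0, hence
   the case distinction. *)
Definition centered_normal (R : realType) (s : R) (A : set R) : \bar R :=
  if s == 0 then dirac (0 : R) A else normal_prob 0 s A.

Definition has_centered_normal_law d (T : measurableType d) (R : realType)
    (P : probability T R) (X : {RV P >-> R}) (s : R) : Prop :=
  forall A : set R, measurable A -> distribution P X A = centered_normal s A.

Definition mutually_independent d (T : measurableType d) (R : realType)
    (P : probability T R) (I : finType) (X : I -> {RV P >-> R}) : Prop :=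
  forall (J : {set I}) (A : I -> set R), (forall i, measurable (A i)) ->
    P (\bigcap_(i in [set` J]) (X i @^-1` A i)) =
    (\prod_(i in J) P (X i @^-1` A i))%E.

(* All the noise variables as one family, for joint mutual independence. *)
Definition noise d (T : measurableType d) (R : realType)
    (P : probability T R) (M K : nat) (eta eps : 'I_M -> 'I_K -> {RV P >-> R})
    (i : ('I_M * 'I_K) + ('I_M * 'I_K)) : {RV P >-> R} :=
  match i with
  | inl mk => eta mk.1 mk.2
  | inr mk => eps mk.1 mk.2
  end.

Definition measurement d (T : measurableType d) (R : realType)
    (P : probability T R) (M K : nat) (rho : 'cV[R]_2 -> R)
    (z : 'I_M -> 'cV[R]_2) (phi : 'I_K -> R)
    (eta eps : 'I_M -> 'I_K -> {RV P >-> R}) (w : T)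
    (m : 'I_M) (k : 'I_K) : R :=
  rho (z m) * phi k + eta m k w * phi k + eps m k w.

Definition quadratic_model (R : realType) (c : 'cV[R]_2)
    (alpha : R) (beta : 'cV[R]_2) (B : 'M[R]_2) (x : 'cV[R]_2) : R :=
  alpha + (beta^T *m (x - c)) 0 0 + ((x - c)^T *m B *m (x - c)) 0 0.

Definition wls_objective (R : realType) (M K : nat) (kappa : 'cV[R]_2 -> R)
    (b : R) (z : 'I_M -> 'cV[R]_2) (c : 'cV[R]_2) (phi : 'I_K -> R)
    (gamma : 'I_M -> 'I_K -> R)
    (alpha : R) (beta : 'cV[R]_2) (B : 'M[R]_2) : R :=
  \sum_(m < M) \sum_(k < K)
    (gamma m k - phi k * quadratic_model c alpha beta B (z m)) ^+ 2
      * kappa (b^-1 *: (z m - c)).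

Definition wls_minimizer (R : realType) (M K : nat) (kappa : 'cV[R]_2 -> R)
    (b : R) (z : 'I_M -> 'cV[R]_2) (c : 'cV[R]_2) (phi : 'I_K -> R)
    (gamma : 'I_M -> 'I_K -> R)
    (alpha : R) (beta : 'cV[R]_2) (B : 'M[R]_2) : Prop :=
  forall (alpha' : R) (beta' : 'cV[R]_2) (B' : 'M[R]_2),
    wls_objective kappa b z c phi gamma alpha beta B
      <= wls_objective kappa b z c phi gamma alpha' beta' B'.

(* Uniqueness is asked of the coefficient alpha only: beta and B (in any case
   its antisymmetric part) may be undetermined. *)
Definition nondegenerate_sensors (R : realType) (M K : nat) (kappa : 'cV[R]_2 -> R)
    (b : R) (z : 'I_M -> 'cV[R]_2) (c : 'cV[R]_2) (phi : 'I_K -> R) : Prop :=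
  forall (gamma : 'I_M -> 'I_K -> R) (alpha1 alpha2 : R)
    (beta1 beta2 : 'cV[R]_2) (B1 B2 : 'M[R]_2),
    wls_minimizer kappa b z c phi gamma alpha1 beta1 B1 ->
    wls_minimizer kappa b z c phi gamma alpha2 beta2 B2 ->
    alpha1 = alpha2.

(* Main.v *)
(* The normal equations, paired with any v in the coefficient space, say that
   the fitted and the averaged data agree against the weights w_m <x_m, v>,
   where x_m is the vector of monomials at sensor m.  Nondegeneracy puts the
   coordinate form alpha in the row space of the Gram matrix of the w_m, x_m, so
   for a suitable v the left side is alpha itself:
     alpha_hat = sum_m u_m (sum_k phi_k gamma_mk) / (sum_k phi_k^2)
   with u_m depending on the sensors, c, kappa and b only.  Hence the error is a
   constant plus a linear combination of independent centered normal variables,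
   and C = sum_m u_m^2. *)
Require Import Defs.
From HB Require Import structures.
From mathcomp Require Import all_boot all_order all_algebra.
From mathcomp Require Import all_classical all_reals all_analysis.
From mathcomp Require Import measurable_realfun ring lra.
Import Order.TTheory GRing.Theory Num.Theory.
Import numFieldNormedType.Exports.
Local Open Scope classical_set_scope.
Local Open Scope ring_scope.

Set Implicit Arguments.
Unset Strict Implicit.

(** * Normal equations of weighted least squares *)

(** The columns of [cokermx G] lie in the kernel of [G], so [e] vanishes on them, and this is
    membership in the row space. *)
Lemma submx_sym_kernel (F : fieldType) (n : nat) (G : 'M[F]_n) (e : 'rV[F]_n) :
  G^T = G -> (forall t : 'cV[F]_n, G *m t = 0 -> e *m t = 0) -> (e <= G)%MS.
Proof.
move=> symG ker_e; rewrite submxE; apply/eqP/matrixP => i j; rewrite ord1 mxE.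
have /ker_e/matrixP/(_ 0 0) : G *m col j (cokermx G) = 0.
  by rewrite colE mulmxA mulmx_coker mul0mx.
rewrite !mxE => e0; rewrite -[RHS]e0.
by apply: eq_bigr => k _; rewrite !mxE ?ord1.
Qed.

(** Near 0 a nonzero linear term beats any quadratic one. This yields first-order conditions without
    differentiation. *)
Lemma lin_coef_eq0 (R : realFieldType) (a l : R) :
  (forall t, l * t <= a * t ^+ 2) -> l = 0.
Proof.
move=> le_lin; have [//|l0] := eqVneq l 0; exfalso.
have d0 : 0 < `|a| + 1 by rewrite ltr_pwDr.
(* A test point on the side where the linear term is positive; [|a| + 1] is positive and strictly
   above [a]. *)
have := le_lin (l / (`|a| + 1)); rewrite expr_div_n mulrA -expr2 => le1.
have : l ^+ 2 * (`|a| + 1) <= a * l ^+ 2.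
  have := ler_wpM2r (exprn_ge0 2 (ltW d0)) le1.
  have -> : l ^+ 2 / (`|a| + 1) * (`|a| + 1) ^+ 2 = l ^+ 2 * (`|a| + 1).
    by field; rewrite gt_eqF.
  by have -> : a * (l ^+ 2 / (`|a| + 1) ^+ 2) * (`|a| + 1) ^+ 2 = a * l ^+ 2
    by field; rewrite gt_eqF.
rewrite mulrC ler_pM2r ?exprn_even_gt0//.
by rewrite leNgt (le_lt_trans (ler_norm a))// ltrDl.
Qed.

Definition gram (R : realFieldType) (M n : nat) (w : 'I_M -> R)
    (x : 'I_M -> 'rV[R]_n) : 'M[R]_n :=
  \sum_(m < M) w m *: ((x m)^T *m x m).

Lemma gram_sym (R : realFieldType) (M n : nat) (w : 'I_M -> R)
    (x : 'I_M -> 'rV[R]_n) : (gram w x)^T = gram w x.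
Proof.
rewrite /gram linear_sum; apply: eq_bigr => m _.
by rewrite linearZ /= trmx_mul trmxK.
Qed.

Lemma gram_bilin (R : realFieldType) (M n : nat) (w : 'I_M -> R)
    (x : 'I_M -> 'rV[R]_n) (v : 'rV[R]_n) (t : 'cV[R]_n) :
  (v *m gram w x *m t) 0 0 =
  \sum_(m < M) w m * (x m *m v^T) 0 0 * (x m *m t) 0 0.
Proof.
rewrite /gram mulmx_sumr mulmx_suml summxE; apply: eq_bigr => m _.
rewrite -scalemxAr -scalemxAl mxE mulmxA -(mulmxA (v *m _)) -mulrA.
congr (_ * _).
have -> : x m *m v^T = (v *m (x m)^T)^T by rewrite trmx_mul trmxK.
by rewrite [LHS]mxE big_ord1 [X in _ = X * _]mxE.
Qed.

(** Pairing with [t] itself gives a vanishing sum of nonnegative terms, so each term vanishes. *)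
Lemma gram_kernel (R : realFieldType) (M n : nat) (w : 'I_M -> R)
    (x : 'I_M -> 'rV[R]_n) (t : 'cV[R]_n) : (forall m, 0 <= w m) ->
  gram w x *m t = 0 -> forall m, w m * (x m *m t) 0 0 ^+ 2 = 0.
Proof.
move=> w0 Gt0.
have sum0 : \sum_(m < M) w m * (x m *m t) 0 0 ^+ 2 = 0.
  have := gram_bilin w x t^T t.
  rewrite -mulmxA Gt0 mulmx0 mxE trmxK => G0; rewrite [RHS]G0.
  by apply: eq_bigr => m _; rewrite expr2 mulrA.
move=> m; apply/eqP.
have := psumr_eq0P _ sum0; rewrite /= => /(_ _ m isT) ->//.
by move=> i _; rewrite mulr_ge0// sqr_ge0.
Qed.

Definition lsq (R : realFieldType) (M K n : nat) (w : 'I_M -> R)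
    (x : 'I_M -> 'rV[R]_n) (phi : 'I_K -> R) (g : 'I_M -> 'I_K -> R)
    (t : 'cV[R]_n) : R :=
  \sum_(m < M) \sum_(k < K) (g m k - phi k * (x m *m t) 0 0) ^+ 2 * w m.

(** Moving from the minimizer [t] to [t + e *: p] changes the objective by [a * e ^+ 2 - 2 * l * e],
    which must be nonnegative for every [e]; hence [l = 0]. *)
Lemma lsq_normal_eq (R : realFieldType) (M K n : nat) (w : 'I_M -> R)
    (x : 'I_M -> 'rV[R]_n) (phi : 'I_K -> R) (g : 'I_M -> 'I_K -> R)
    (t : 'cV[R]_n) :
  (forall t', lsq w x phi g t <= lsq w x phi g t') ->
  forall p : 'cV[R]_n,
    \sum_(m < M) w m * (x m *m p) 0 0 * \sum_(k < K) phi k * g m k =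
    (\sum_(k < K) phi k ^+ 2) *
      \sum_(m < M) w m * (x m *m p) 0 0 * (x m *m t) 0 0.
Proof.
move=> tmin p; apply/eqP; rewrite -subr_eq0; apply/eqP.
set l := _ - _.
pose a := \sum_(m < M) \sum_(k < K) phi k ^+ 2 * (x m *m p) 0 0 ^+ 2 * w m.
have lE : l = \sum_(m < M) \sum_(k < K)
    phi k * (x m *m p) 0 0 * (g m k - phi k * (x m *m t) 0 0) * w m.
  rewrite /l mulr_sumr -sumrB; apply: eq_bigr => m _.
  rewrite mulr_sumr mulr_suml -sumrB; apply: eq_bigr => k _; ring.
suff /lin_coef_eq0 : forall e, (2 * l) * e <= a * e ^+ 2.
  by move/eqP; rewrite mulf_eq0 pnatr_eq0 => /eqP.
move=> e; rewrite -subr_ge0.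
have := tmin (t + e *: p); rewrite -subr_ge0; congr (0 <= _).
rewrite lE mulr_sumr !mulr_suml /lsq -!sumrB; apply: eq_bigr => m _.
rewrite mulr_sumr !mulr_suml -!sumrB; apply: eq_bigr => k _.
rewrite mulmxDr -scalemxAr !mxE; ring.
Qed.

(** * The quadratic model as a linear one, and its coefficient alpha *)

(** The form y^T B y is linear in B: it pairs the entries of B with those of y y^T. The mixed
    monomial occurs twice, so the Gram matrix of these features is singular and only a
    pseudo-inverse is available. *)
Definition quad_feature (R : realType) (y : 'cV[R]_2) :
    'rV[R]_(1 + (2 + 2 * 2)) :=
  row_mx 1%:M (row_mx y^T (mxvec (y *m y^T))).

Definition quad_coef (R : realType) (alpha : R) (beta : 'cV[R]_2)
    (B : 'M[R]_2) : 'cV[R]_(1 + (2 + 2 * 2)) :=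
  col_mx alpha%:M (col_mx beta (mxvec B)^T).

Lemma quad_featureM (R : realType) (c : 'cV[R]_2) (alpha : R)
    (beta : 'cV[R]_2) (B : 'M[R]_2) (y : 'cV[R]_2) :
  (quad_feature (y - c) *m quad_coef alpha beta B) 0 0 =
  quadratic_model c alpha beta B y.
Proof.
rewrite /quad_feature /quad_coef /quadratic_model; set u := y - c.
have dotB : mxvec (u *m u^T) *m (mxvec B)^T = u^T *m B *m u.
  by have := mxvec_dotmul B u^T u^T; rewrite trmxK.
rewrite !mul_row_col mul1mx dotB mxE [X in X + _]mxE eqxx mulr1n.
rewrite [X in _ + X]mxE addrA; congr (_ + _ + _).
by rewrite !mxE; apply: eq_bigr => i _; rewrite !mxE mulrC.
Qed.

(** Lets minimality over triples (alpha, beta, B) be read as minimality over all column vectors. *)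
Lemma quad_coef_surj (R : realType) (t : 'cV[R]_(1 + (2 + 2 * 2))) :
  exists alpha beta B, t = quad_coef alpha beta B.
Proof.
exists (usubmx t 0 0), (usubmx (dsubmx t)), (vec_mx (dsubmx (dsubmx t))^T).
by rewrite /quad_coef vec_mxK trmxK -mx11_scalar !vsubmxK.
Qed.

Lemma wls_objectiveE (R : realType) (M K : nat) (kappa : 'cV[R]_2 -> R)
    (b : R) (z : 'I_M -> 'cV[R]_2) (c : 'cV[R]_2) (phi : 'I_K -> R)
    (g : 'I_M -> 'I_K -> R) (alpha : R) (beta : 'cV[R]_2) (B : 'M[R]_2) :
  wls_objective kappa b z c phi g alpha beta B =
  lsq (fun m => kappa (b^-1 *: (z m - c)))
    (fun m => quad_feature (z m - c)) phi g (quad_coef alpha beta B).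
Proof.
by apply: eq_bigr => m _; apply: eq_bigr => k _; rewrite quad_featureM.
Qed.

(* v solves v * gram = e provided that e lies in the row space of gram, which is
   what nondegeneracy ensures; otherwise pinvmx yields a junk v. *)
Definition wls_weight (R : realType) (M : nat) (kappa : 'cV[R]_2 -> R)
    (b : R) (z : 'I_M -> 'cV[R]_2) (c : 'cV[R]_2) (m : 'I_M) : R :=
  let w m := kappa (b^-1 *: (z m - c)) in
  let x m := quad_feature (z m - c) in
  let e : 'rV_(1 + (2 + 2 * 2)) := delta_mx 0 (lshift _ 0) in
  let v := e *m pinvmx (gram w x) in
  w m * (x m *m v^T) 0 0.

(** If every phi_k were zero, the objective would ignore the coefficients and every alpha would be
    minimal, against uniqueness. The case K = 0 is thereby excluded too. *)
Lemma nondegenerate_sum_sqr_neq0 (R : realType) (M K : nat)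
    (kappa : 'cV[R]_2 -> R) (b : R) (z : 'I_M -> 'cV[R]_2) (c : 'cV[R]_2)
    (phi : 'I_K -> R) :
  nondegenerate_sensors kappa b z c phi -> \sum_(k < K) phi k ^+ 2 != 0.
Proof.
move=> nd; apply/eqP => S0.
have phi0 k : phi k = 0.
  have := psumr_eq0P (fun k _ => sqr_ge0 (phi k)) S0.
  by move=> /(_ k isT)/eqP; rewrite sqrf_eq0 => /eqP.
have min0 a : wls_minimizer kappa b z c phi (fun _ _ => 0) a 0 0.
  move=> a' beta' B'; rewrite /wls_objective.
  under eq_bigr do under eq_bigr do rewrite phi0 mul0r.
  by under [leRHS]eq_bigr do under eq_bigr do rewrite phi0 mul0r.
by have /eqP := nd _ _ _ _ _ _ _ (min0 0) (min0 1); rewrite eq_sym oner_eq0.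
Qed.

Lemma wls_alpha_linear (R : realType) (M K : nat) (kappa : 'cV[R]_2 -> R)
    (b : R) (z : 'I_M -> 'cV[R]_2) (c : 'cV[R]_2) (phi : 'I_K -> R)
    (g : 'I_M -> 'I_K -> R) (alpha : R) (beta : 'cV[R]_2) (B : 'M[R]_2) :
  (forall u, 0 <= kappa u) -> nondegenerate_sensors kappa b z c phi ->
  wls_minimizer kappa b z c phi g alpha beta B ->
  alpha = \sum_(m < M) wls_weight kappa b z c m *
    ((\sum_(k < K) phi k * g m k) / \sum_(k < K) phi k ^+ 2).
Proof.
move=> kappa0 nd tmin; have S0 := nondegenerate_sum_sqr_neq0 nd.
rewrite /wls_weight; set w := fun m => kappa _.
set x := fun m => quad_feature _.
set e := delta_mx 0 _; set G := gram _ _; set v := e *m _.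
have w0 m : 0 <= w m by exact: kappa0.
have eE a be C : (e *m quad_coef a be C) 0 0 = a.
  by rewrite -rowE mxE col_mxEu mxE eqxx.
(* Nondegeneracy is applied to zero data: a vector in the kernel of [G] has objective 0, as have the
   zero coefficients, so both are minimizers and its alpha coordinate is 0. *)
have vG : v *m G = e.
  rewrite mulmxKpV//; apply: submx_sym_kernel; first exact: gram_sym.
  move=> t Gt0; have [a [be [C tE]]] := quad_coef_surj t.
  have t0 := gram_kernel w0 Gt0.
  have objt : wls_objective kappa b z c phi (fun _ _ => 0) a be C = 0.
    rewrite wls_objectiveE -tE /lsq big1// => m _; rewrite big1// => k _.
    rewrite sub0r sqrrN exprMn -mulrA [X in _ * X]mulrC.
    by have := t0 m; rewrite /w /x => ->; rewrite mulr0.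
  have obj0 : wls_objective kappa b z c phi (fun _ _ => 0) 0 0 0 = 0.
    rewrite /wls_objective big1// => m _; rewrite big1// => k _.
    rewrite /quadratic_model trmx0 mul0mx mulmx0 mul0mx !mxE !addr0.
    by rewrite mulr0 subr0 expr0n mul0r.
  have ge0 a' be' C' :
      0 <= wls_objective kappa b z c phi (fun _ _ => 0) a' be' C'.
    apply: sumr_ge0 => m _; apply: sumr_ge0 => k _.
    by rewrite mulr_ge0 ?sqr_ge0.
  apply/matrixP => i j; rewrite !ord1 [RHS]mxE tE eE.
  apply: (nd (fun _ _ => 0) _ _ be 0 C 0) => a' be' C'.
    by rewrite objt.
  by rewrite obj0.
have := @lsq_normal_eq R M K _ w x phi g (quad_coef alpha beta B).
have mint t' : lsq w x phi g (quad_coef alpha beta B)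
    <= lsq w x phi g t'.
  have [a [be [C ->]]] := quad_coef_surj t'.
  by have := tmin a be C; rewrite !wls_objectiveE.
(* In the direction [v^T] the fitted side of the normal equations is v G t = e t, that is alpha. *)
move=> /(_ mint v^T) nE.
rewrite -[LHS](eE alpha beta B) -vG gram_bilin.
apply: (mulfI S0); rewrite -nE mulr_sumr; apply: eq_bigr => m _.
by rewrite -/(w m) -/(x m); field.
Qed.

(** * The second moment of the normal density *)

(** The Radon-Nikodym derivative of the normal law and [normal_pdf] have the same integral over
    every measurable set, hence agree almost everywhere. *)
Lemma ge0_integral_normal_prob (R : realType) (s : R) (f : R -> \bar R) :
  measurable_fun [set: R] f -> (forall x, (0 <= f x)%E) ->
  (\int[normal_prob 0 s]_x f x =
   \int[lebesgue_measure]_x (f x * (normal_pdf 0 s x)%:E))%E.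
Proof.
move=> mf f0.
pose nu : probability _ R := normal_prob 0 s.
have numu : nu `<< lebesgue_measure := normal_prob_dominates 0 s.
rewrite -[LHS](Radon_Nikodym_SigmaFinite.change_of_variables numu f0)//.
pose g := Radon_Nikodym_SigmaFinite.f nu lebesgue_measure.
have ig : lebesgue_measure.-integrable setT g.
  exact: Radon_Nikodym_SigmaFinite.f_integrable.
have mpdf : measurable_fun [set: R] (fun x => (normal_pdf 0 s x)%:E).
  by apply/measurable_EFinP; exact: measurable_normal_pdf.
apply: ae_eq_integral => //.
- exact: emeasurable_funM mf (measurable_int _ ig).
- exact: emeasurable_funM mf mpdf.
- apply: ae_eqe_mul2l; apply: integral_ae_eq => //.
  + by move=> E _ mE; rewrite -Radon_Nikodym_SigmaFinite.f_integral.
Qed.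


Lemma is_derive_normal_pdf (R : realType) (s x : R) : s != 0 ->
  is_derive x 1 (normal_pdf 0 s) (- (x / s ^+ 2) * normal_pdf 0 s x).
Proof.
move=> s0; rewrite normal_pdfE//.
pose k : R := - (s ^+ 2 *+ 2)^-1.
have hE y : normal_fun 0 s y = expR (k * y ^+ 2).
  by rewrite /normal_fun subr0 /k !mulNr mulrC.
rewrite (_ : (fun y => _) = (fun y => normal_peak s * expR (k * y ^+ 2)));
  last first.
  by apply/funext => y; rewrite hE.
rewrite hE; apply: is_derive_eq.
rewrite /k /GRing.scale/=; field.
exact: s0.
Qed.

Lemma normal_pdf_opp (R : realType) (s x : R) :  s != 0 ->
  normal_pdf 0 s (- x) = normal_pdf 0 s x.
Proof. by move=> s0; rewrite normal_pdfE// /normal_fun !subr0 sqrrN. Qed.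

(** From y <= exp y at y = x^2 / (2 s^2). *)
Lemma sqr_mul_normal_pdf_le (R : realType) (s x : R) : s != 0 ->
  x ^+ 2 * normal_pdf 0 s x <= normal_peak s * (s ^+ 2 *+ 2).
Proof.
move=> s0; rewrite normal_pdfE// /normal_fun subr0 mulrCA.
rewrite ler_wpM2l ?normal_peak_ge0// mulNr expRN ler_pdivrMr ?expR_gt0//.
have d0 : 0 < s ^+ 2 *+ 2 by rewrite pmulrn_lgt0// exprn_even_gt0.
rewrite mulrC -ler_pdivrMr//.
by rewrite (le_trans _ (expR_ge1Dx _))// lerDr.
Qed.

(** This is the boundary term of the integration by parts below; the bound on x^2 times the density
    leaves a factor 1/n. *)
Lemma cvg_mul_normal_pdf (R : realType) (s : R) : s != 0 ->
  n%:R * normal_pdf 0 s n%:R @[n --> \oo] --> 0.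
Proof.
move=> s0; set c := normal_peak s * (s ^+ 2 *+ 2).
have cvgc : c * n%:R^-1 @[n --> \oo] --> 0.
  rewrite -(mulr0 c); apply: cvgM; first exact: cvg_cst.
  rewrite gtr0_cvgV0; first exact: cvgr_idn.
  by near=> n; rewrite ltr0n; near: n; exists 1.
apply: (squeeze_cvgr _ (cvg_cst 0) cvgc).
near=> n; have n0 : (0 : R) < n%:R.
  by rewrite ltr0n; near: n; exists 1.
rewrite mulr_ge0 ?normal_pdf_ge0// ?ler0n//=.
by rewrite ler_pdivlMr// mulrAC -expr2 sqr_mul_normal_pdf_le.
Unshelve. all: by end_near. Qed.

Lemma continuous_sqr_mul_normal_pdf (R : realType) (s : R) : s != 0 ->
  continuous (fun x : R => x ^+ 2 * normal_pdf 0 s x).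
Proof.
move=> s0 x; apply: cvgM; first exact: exprn_continuous.
exact: continuous_normal_pdf.
Qed.

(* Integration by parts: s^2 (normal_pdf 0 s)' = - x (normal_pdf 0 s x). *)
Lemma integral_sqr_normal_pdf_itv (R : realType) (s : R) (n : nat) : s != 0 ->
  (\int[lebesgue_measure]_(x in `[0%R, n%:R]) (x ^+ 2 * normal_pdf 0 s x)%:E =
   (s ^+ 2)%:E *
     (\int[lebesgue_measure]_(x in `[0%R, n%:R]) (normal_pdf 0 s x)%:E
      - (n%:R * normal_pdf 0 s n%:R)%:E))%E.
Proof.
(* Integration by parts requires a nondegenerate interval, so n = 0 is treated apart. *)
move=> s0; have [->|n0] := posnP n.
  by rewrite mul0r sube0 set_itv1 !integral_set1 mule0.
have cpdf := continuous_normal_pdf (m := 0) s0.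
have cg : continuous (fun x : R => - (x / s ^+ 2) * normal_pdf 0 s x).
  move=> x; apply: cvgM; last exact: cpdf.
  apply: cvgN; apply: cvgM; [exact: cvg_id|exact: cvg_cst].
have n0' : (0 : R) < n%:R by rewrite ltr0n.
pose G := normal_pdf 0 s; pose g x : R := - (x / s ^+ 2) * G x.
have dG (x : R) : is_derive x 1 G (g x) := is_derive_normal_pdf x s0.
have did : derivable_oo_LRcontinuous (id : R -> R) 0 n%:R.
  split=> [x _||]; first exact: derivable_id.
    by apply: cvg_at_right_filter; exact: cvg_id.
  by apply: cvg_at_left_filter; exact: cvg_id.
have dGn : derivable_oo_LRcontinuous G 0 n%:R.
  split=> [x _||]; first by have [] := dG x.
    by apply: cvg_at_right_filter; exact: cpdf.
  by apply: cvg_at_left_filter; exact: cpdf.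
have id1 : {in `]0, n%:R[, ((id : R -> R)^`())%classic =1 cst 1}.
  by move=> x _; rewrite derive1E derive_id.
have Gg : {in `]0, n%:R[, (G^`())%classic =1 g}.
  by move=> x _; rewrite derive1E; exact: derive_val.
have c1 : continuous (cst 1 : R -> R) by move=> x; exact: cvg_cst.
have intG : lebesgue_measure.-integrable `[0%R, n%:R] (EFin \o G).
  by apply: continuous_compact_integrable;
    [exact: segment_compact|exact: continuous_subspaceT].
have := integration_by_parts n0' (continuous_subspaceT c1) did id1
  (continuous_subspaceT cg) dGn Gg.
rewrite mul0r subr0.
under [X in (_ = _ - X)%E -> _]eq_integral do rewrite mul1r.
move=> parts.
have -> : (\int[lebesgue_measure]_(x in `[0%R, n%:R]) (x ^+ 2 * G x)%:E
   = (- s ^+ 2)%:E * \int[lebesgue_measure]_(x in `[0%R, n%:R]) (x * g x)%:E)%E.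
  rewrite -integralZl//.
    by apply: eq_integral => x _; rewrite -EFinM /g; congr EFin; field.
  apply: continuous_compact_integrable; first exact: segment_compact.
  apply: continuous_subspaceT => x; apply: cvgM; [exact: cvg_id|exact: cg].
rewrite parts EFinN mulNe -muleN fin_num_oppeB ?integrable_fin_num//.
by rewrite addeC.
Qed.

(** By evenness the half-line suffices, and it is exhausted by the intervals [0, n]. In the limit
    the boundary term vanishes and the density contributes its half mass 1/2. *)
Lemma integral_sqr_normal_pdf (R : realType) (s : R) : s != 0 ->
  (\int[lebesgue_measure]_x (x ^+ 2 * normal_pdf 0 s x)%:E = (s ^+ 2)%:E)%E.
Proof.
move=> s0; have cpdf := continuous_normal_pdf (m := 0) s0.
have nneg : [set x : R | 0 <= x] = `[0%R, +oo[%classic.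
  by apply/seteqP; split => x /=; rewrite in_itv/= andbT.
have pdf_half : (\int[lebesgue_measure]_(x in `[0%R, +oo[) (normal_pdf 0 s x)%:E
    = (2^-1)%:E)%E.
  have := integral_normal_pdf 0 s.
  rewrite ge0_symfun_integralT//; first last.
  - by move=> x; rewrite /= normal_pdf_opp.
  - exact: normal_pdf_ge0.
  rewrite nneg => /(congr1 (fun y => (2^-1)%:E * y)%E).
  by rewrite muleA -EFinM mulVf ?mul1e ?mule1 ?pnatr_eq0.
have ge0 x : 0 <= x ^+ 2 * normal_pdf 0 s x.
  by rewrite mulr_ge0 ?sqr_ge0 ?normal_pdf_ge0.
have c2 := continuous_sqr_mul_normal_pdf s0.
rewrite ge0_symfun_integralT//; last first.
  by move=> x; rewrite /= normal_pdf_opp// sqrrN.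
rewrite nneg.
have m2 := continuous_measurable_fun c2.
have lim1 := ge0_cvgn_integral (mu := lebesgue_measure) ge0 m2.
have lim0 := ge0_cvgn_integral (mu := lebesgue_measure)
  (normal_pdf_ge0 0 s) (measurable_normal_pdf 0 s).
have lim2 : ((s ^+ 2)%:E *
     (\int[lebesgue_measure]_(x in `[0%R, n%:R]) (normal_pdf 0 s x)%:E
      - (n%:R * normal_pdf 0 s n%:R)%:E))%E
    @[n --> \oo] --> (s ^+ 2 * 2^-1)%:E.
  rewrite [X in _ --> X]EFinM; apply: cvgeZl => //.
  rewrite -[X in _ --> X]sube0; apply: cvgeB => //.
  - by rewrite -pdf_half.
  - apply: cvg_EFin; first by near=> n.
    exact: cvg_mul_normal_pdf.
have {}lim2 : (\int[lebesgue_measure]_(x in `[0%R, n%:R])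
    (x ^+ 2 * normal_pdf 0 s x)%:E)%E @[n --> \oo] --> (s ^+ 2 * 2^-1)%:E.
  by under eq_cvg do rewrite integral_sqr_normal_pdf_itv//.
rewrite (cvg_unique _ lim1 lim2)// -EFinM mulrCA divff ?mulr1 ?pnatr_eq0//.
Unshelve. all: by end_near. Qed.

(** * Square integrability, independence and variances of sums *)

Lemma Lfun2_sqr_lty d (T : measurableType d) (R : realType)
    (P : probability T R) (X : {RV P >-> R}) :
  ('E_P[fun w => (X w ^+ 2)%R] < +oo)%E -> (X : T -> R) \in Lfun P 2%:E.
Proof.
move=> EX2; rewrite inE; apply/andP; split; rewrite inE /=.
  exact: measurable_funP.
rewrite /finite_norm unlock /=; apply: poweR_lty.
move: EX2; rewrite unlock; apply: le_lt_trans.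
rewrite le_eqVlt; apply/orP; left; apply/eqP.
by apply: eq_integral => w _; rewrite powR_mulrn// real_normK ?num_real.
Qed.

(** Independence says that the joint law agrees with the product of the two laws on rectangles,
    hence everywhere; Fubini then splits the integral of the product. *)
Lemma expectationM_indep d (T : measurableType d) (R : realType)
    (P : probability T R) (X Y : {RV P >-> R}) :
  (forall A B, measurable A -> measurable B ->
    P ((X @^-1` A) `&` (Y @^-1` B)) = P (X @^-1` A) * P (Y @^-1` B))%E ->
  (X : T -> R) \in Lfun P 1 -> (Y : T -> R) \in Lfun P 1 ->
  ((X : T -> R) * (Y : T -> R)) \in Lfun P 1 ->
  ('E_P[(X : T -> R) * (Y : T -> R)] = 'E_P[X] * 'E_P[Y])%E.
Proof.
move=> XY lX lY lXY.
have /Lfun1_integrable iX := lX; have /Lfun1_integrable iY := lY.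
have /Lfun1_integrable iXY := lXY.
pose Z (w : T) : R * R := (X w, Y w).
have mZ : measurable_fun setT Z by exact: measurable_fun_pair.
pose Zm : {mfun T >-> (R * R)%type} :=
  mfun_Sub (mem_set mZ).
pose f (p : R * R) : \bar R := (p.1 * p.2)%:E.
have mf : measurable_fun setT f.
  by apply/measurable_EFinP; exact: measurable_funM.
pose mu := (distribution P X \x distribution P Y)%E.
have muE A : measurable A -> mu A = distribution P Zm A.
  by apply: product_measure_unique => A1 A2 mA1 mA2; exact: XY.
have imf : mu.-integrable setT f.
  apply/integrableP; split => //.
  rewrite (eq_measure_integral (distribution P Zm)) => [|A mA _];
    last exact: muE.
  rewrite ge0_integral_distribution//; last exact: measurableT_comp.
  by have /integrableP[] := iXY.
have int_id (V : {RV P >-> R}) : P.-integrable setT (EFin \o V) ->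
    (distribution P V).-integrable setT EFin /\
    (\int[distribution P V]_y y%:E = 'E_P[V])%E.
  move=> iV; rewrite expectation_def; split; last exact: integral_distribution.
  apply/integrableP; split => //.
  rewrite ge0_integral_distribution//; first by have /integrableP[] := iV.
  by apply: measurableT_comp => //; exact: EFin_measurable.
have [iX' EX] := int_id X iX; have [iY' EY] := int_id Y iY.
transitivity (\int[mu]_p f p)%E.
  rewrite (eq_measure_integral (distribution P Zm)) => [|A mA _];
    last exact: muE.
  by rewrite integral_distribution// unlock.
rewrite -integral12_prod_meas1//.
transitivity (\int[distribution P X]_x (x%:E * 'E_P[Y]))%E.
  apply: eq_integral => x _; rewrite /fubini_F /f /=.
  by under eq_integral do rewrite EFinM; rewrite integralZl// EY.
have /fineK <- : ('E_P[Y] \is a fin_num)%E by exact: expectation_fin_num.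
by rewrite integralZr// EX.
Qed.

(** Bienaymé's identity, stated over a duplicate-free list to allow induction. *)
Lemma variance_sum_uncorrelated d (T : measurableType d) (R : realType)
    (P : probability T R) (I : eqType) (s : seq I) (X : I -> T -> R) :
  uniq s -> (forall i, X i \in Lfun P 2%:E) ->
  (forall i j, i != j -> covariance P (X i) (X j) = 0%E) ->
  variance P (fun w => \sum_(i <- s) X i w) =
  (\sum_(i <- s) variance P (X i))%E.
Proof.
move=> us X2 X0.
have S2 r : (fun w => \sum_(i <- r) X i w) \in Lfun P 2%:E.
  rewrite (_ : (fun w => _) = \sum_(i <- r) X i); last first.
    by apply/funext => w; rewrite fct_sumE.
  by rewrite rpred_sum ?lee1n.
elim: s us => [_|i s IH /= /andP[ins us]].
  rewrite big_nil (_ : (fun w => _) = cst 0) ?variance_cst//.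
  by apply/funext => w; rewrite big_nil.
have -> : (fun w => \sum_(j <- i :: s) X j w) =
    X i \+ (fun w => \sum_(j <- s) X j w).
  by apply/funext => w; rewrite big_cons.
rewrite varianceD// IH// big_cons.
suff -> : covariance P (X i) (fun w => \sum_(j <- s) X j w) = 0%E.
  by rewrite mule0 adde0.
(* A second induction: the head is uncorrelated with each later term, hence with their sum. *)
elim: s ins {us IH} => [_|j s IH].
  rewrite (_ : (fun w => _) = cst 0) ?covariance_cst_r//.
  by apply/funext => w; rewrite big_nil.
rewrite inE negb_or => /andP[ij ins].
have -> : (fun w => \sum_(k <- j :: s) X k w) =
    X j \+ (fun w => \sum_(k <- s) X k w).
  by apply/funext => w; rewrite big_cons.
by rewrite covarianceDr// X0// IH// adde0.
Qed.

(** * Moments of centered normal laws *)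

(** Lebesgue measure is invariant under reflection and the density is even; in the degenerate case
    the Dirac mass sits at the fixed point 0. *)
Lemma centered_normal_opp (R : realType) (s : R) (A : set R) :
  measurable A -> centered_normal s (-%R @^-1` A) = centered_normal s A.
Proof.
move=> mA; rewrite /centered_normal; have [_|s0] := eqVneq s 0.
  rewrite !diracE; congr (_%:R%:E); congr nat_of_bool.
  by apply/idP/idP; rewrite !inE /= oppr0.
have mpdf : measurable_fun [set: R] (fun x => (normal_pdf 0 s x)%:E).
  by apply/measurable_EFinP; exact: measurable_normal_pdf.
rewrite /normal_prob [RHS](eq_measure_integral (pushforward lebesgue_measure
  (-%R : R -> measurableTypeR R))); last first.
  by move=> B mB _; rewrite -[LHS]lebesgue_measureN.
rewrite ge0_integral_pushforward//=.
- by apply: eq_integral => x _; rewrite /= normal_pdf_opp.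
- exact: measurable_funTS.
- by move=> x _; rewrite lee_fin normal_pdf_ge0.
Qed.

Lemma centered_normal_law_sqr d (T : measurableType d) (R : realType)
    (P : probability T R) (X : {RV P >-> R}) (s : R) :
  has_centered_normal_law X s ->
  ('E_P[fun w => (X w ^+ 2)%R] = (s ^+ 2)%:E)%E.
Proof.
move=> lawX; pose f (y : R) : \bar R := (y ^+ 2)%:E.
(* normal_prob lives on measurableTypeR R, which has the Borel sets of R but
   another display. *)
have mX : measurable_fun setT (X : T -> measurableTypeR R).
  exact: measurable_funP X.
pose X' : {RV P >-> measurableTypeR R} :=
  @mfun_Sub _ _ T (measurableTypeR R) X (mem_set mX).
have mf : measurable_fun [set: measurableTypeR R] f.
  by apply/measurable_EFinP; exact: (@measurable_funX _ (measurableTypeR R)).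
have f0 y : (0 <= f y)%E by rewrite lee_fin sqr_ge0.
have lawX' (A : set (measurableTypeR R)) : measurable A ->
  distribution P X' A = centered_normal s A by exact: lawX.
rewrite unlock -[LHS](ge0_integral_distribution X' mf f0).
have [s0|s0] := eqVneq s 0.
  rewrite (eq_measure_integral (dirac (0 : measurableTypeR R))); last first.
    by move=> A mA _; rewrite [LHS]lawX'// /centered_normal s0 eqxx.
  by rewrite integral_dirac// diracT mul1e /f s0 !expr0n.
transitivity (\int[normal_prob 0 s]_y f y)%E.
  apply: eq_measure_integral => A mA _.
  by rewrite [LHS]lawX'// /centered_normal (negbTE s0).
by rewrite ge0_integral_normal_prob// -[RHS]integral_sqr_normal_pdf.
Qed.

Lemma centered_normal_law_Lfun2 d (T : measurableType d) (R : realType)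
    (P : probability T R) (X : {RV P >-> R}) (s : R) :
  has_centered_normal_law X s -> (X : T -> R) \in Lfun P 2%:E.
Proof.
move=> lawX; apply: Lfun2_sqr_lty.
by rewrite (centered_normal_law_sqr lawX) ltry.
Qed.

(** X and -X have the same law, so the mean equals its opposite; being finite, by square
    integrability, it is 0. *)
Lemma centered_normal_law_mean d (T : measurableType d) (R : realType)
    (P : probability T R) (X : {RV P >-> R}) (s : R) :
  has_centered_normal_law X s -> ('E_P[X] = 0)%E.
Proof.
move=> lawX.
have X1 : (X : T -> R) \in Lfun P 1.
  apply: Lfun_subset12 (centered_normal_law_Lfun2 lawX).
  exact: fin_num_measure.
have /Lfun1_integrable iX := X1.
pose Y : {RV P >-> R} := (- X)%R.
have EX : ('E_P[X] = \int[distribution P X]_y y%:E)%E.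
  by rewrite expectation_def integral_distribution.
have EY : ('E_P[Y] = \int[distribution P Y]_y y%:E)%E.
  by rewrite expectation_def integral_distribution//; exact: (integrableN iX).
have EYX : ('E_P[Y] = - 'E_P[X])%E.
  rewrite -[X in (- X)%E]mul1e -mulNe -EFinN -expectationZl//.
  by congr expectation; apply/funext => w; rewrite /= mulrN1.
have : ('E_P[Y] = 'E_P[X])%E.
  rewrite EX EY; apply: eq_measure_integral => A mA _ /=.
  have mNA : measurable (-%R @^-1` A : set R).
    by rewrite -[X in measurable X]setTI; exact: oppr_measurable.
  by rewrite [RHS]lawX// -centered_normal_opp// -(lawX _ mNA).
rewrite EYX; have /fineK <- := expectation_fin_num X1.
rewrite -EFinN => -[]; set e := fine _; move=> e0.
by congr EFin; lra.
Qed.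

(** * Variance of an affine combination of independent normal variables *)

Lemma mutually_independentM d (T : measurableType d) (R : realType)
    (P : probability T R) (I : finType) (X : I -> {RV P >-> R}) (i j : I)
    (A B : set R) :
  mutually_independent X -> i != j -> measurable A -> measurable B ->
  (P ((X i @^-1` A) `&` (X j @^-1` B)) = P (X i @^-1` A) * P (X j @^-1` B))%E.
Proof.
(* Independence takes one family of events; on the pair {i, j} this one gives [A] at i and [B] at j,
   since i and j differ. *)
move=> indX ij mA mB; pose C k := if k == i then A else B.
have mC k : measurable (C k) by rewrite /C; case: ifP.
have := indX (i |: [set j])%SET C mC.
have -> : \bigcap_(k in [set` (i |: [set j])%SET]) (X k @^-1` C k) =
    (X i @^-1` A) `&` (X j @^-1` B).
  have Cj : C j = B by rewrite /C eq_sym (negbTE ij).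
  have Ci : C i = A by rewrite /C eqxx.
  rewrite -Ci -Cj; apply/seteqP; split=> w /=.
    by move=> XC; split; apply: XC; rewrite /= !inE eqxx ?orbT.
  by move=> [XCi XCj] k /=; rewrite !inE => /orP[] /eqP ->.
by rewrite big_setU1 ?inE//= big_set1 /C eqxx eq_sym (negbTE ij).
Qed.

(** The constant drops out, and covariances vanish because independent variables of mean 0 have
    products of mean 0. *)
Lemma variance_affine_normal d (T : measurableType d) (R : realType)
    (P : probability T R) (I : finType) (X : I -> {RV P >-> R}) (s : I -> R)
    (a : I -> R) (a0 : R) :
  (forall i, has_centered_normal_law (X i) (s i)) -> mutually_independent X ->
  variance P (fun w => a0 + \sum_i a i * X i w) =
  (\sum_i a i ^+ 2 * s i ^+ 2)%:E.
Proof.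
move=> lawX indX.
have X2 i : (X i : T -> R) \in Lfun P 2%:E.
  exact: centered_normal_law_Lfun2 (lawX i).
have Pfin : P setT \is a fin_num := fin_num_measure P _ measurableT.
have X1 i : (X i : T -> R) \in Lfun P 1 := Lfun_subset12 Pfin (X2 i).
have X0 i : ('E_P[X i] = 0)%E := centered_normal_law_mean (lawX i).
pose Y i := (a i \o* (X i : T -> R)).
have Y2 i : Y i \in Lfun P 2%:E by rewrite Lfun_scale// ler1n.
have Ysum2 : (fun w => \sum_i Y i w) \in Lfun P 2%:E.
  rewrite (_ : (fun w => _) = \sum_i Y i); last first.
    by apply/funext => w; rewrite fct_sumE.
  by rewrite rpred_sum ?lee1n.
have VX i : variance P (X i) = (s i ^+ 2)%:E.
  rewrite varianceE// X0 expe2 mule0 sube0.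
  exact: centered_normal_law_sqr (lawX i).
rewrite (_ : (fun w => _) = cst a0 \+ (fun w => \sum_i Y i w)); last first.
  apply/funext => w /=; congr (_ + _).
  by apply: eq_bigr => i _; rewrite /= mulrC.
rewrite varianceD_cst_l// variance_sum_uncorrelated ?index_enum_uniq//.
  rewrite -sumEFin; apply: eq_bigr => i _.
  by rewrite varianceZ// VX EFinM.
move=> i j ij.
have XX1 k l : (X k : T -> R) * (X l : T -> R) \in Lfun P 1.
  exact: Lfun2_mul_Lfun1.
rewrite covarianceZl ?covarianceZr//.
- rewrite covarianceE// X0 mul0e sube0 expectationM_indep//.
    by rewrite X0 mul0e !mule0.
  by move=> A B mA mB; exact: mutually_independentM.
- by rewrite Lfun_scale.
- exact: Lfun2_mul_Lfun1.
Qed.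

Unset Implicit Arguments.
Set Strict Implicit.

(** * The variance of the interpolation error *)

Theorem theorem1 (R : realType) (kappa : 'cV[R]_2 -> R)
    (kappa_ge0 : forall u, 0 <= kappa u) (b : R) (b_gt0 : 0 < b)
    (M : nat) (z : 'I_M -> 'cV[R]_2) (c : 'cV[R]_2) :
  exists C : R,
    forall (D : set 'cV[R]_2) (rho : 'cV[R]_2 -> R)
      (K : nat) (phi : 'I_K -> R) (sigma_eta sigma_eps : R)
      (d : measure_display) (T : measurableType d) (P : probability T R)
      (eta eps : 'I_M -> 'I_K -> {RV P >-> R}) (alpha_hat : T -> R),
    bounded_set D ->
    differentiable_on 3 D rho ->
    (forall m, D (z m)) ->
    D c ->
    (forall k, 0 <= phi k) ->
    \sum_(k < K) phi k = K%:R ->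
    0 <= sigma_eta ->
    0 <= sigma_eps ->
    (forall m k, has_centered_normal_law (eta m k) sigma_eta) ->
    (forall m k, has_centered_normal_law (eps m k) sigma_eps) ->
    mutually_independent (noise eta eps) ->
    nondegenerate_sensors kappa b z c phi ->
    (forall w : T, exists (beta : 'cV[R]_2) (B : 'M[R]_2),
       wls_minimizer kappa b z c phi (measurement rho z phi eta eps w)
         (alpha_hat w) beta B) ->
    variance P (fun w => alpha_hat w - rho c) =
    (((\sum_(k < K) phi k ^+ 4) / (\sum_(k < K) phi k ^+ 2) ^+ 2
        * sigma_eta ^+ 2
      + 1 / (\sum_(k < K) phi k ^+ 2) * sigma_eps ^+ 2) * C)%:E.
Proof.
(* The witness is built from the sensors, [c], [kappa] and [b] alone, before the field, the spectrum
   and the noise levels are introduced. *)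
exists (\sum_(m < M) wls_weight kappa b z c m ^+ 2).
move=> D rho K phi s_eta s_eps d T P eta eps alpha_hat _ _ _ _ _ _ _ _.
move=> law_eta law_eps indep nd wls.
have S0 := nondegenerate_sum_sqr_neq0 nd.
set S := \sum_(k < K) phi k ^+ 2 in S0 *.
pose u := wls_weight kappa b z c.
pose s (i : ('I_M * 'I_K) + ('I_M * 'I_K)) :=
  if i is inl _ then s_eta else s_eps.
(* Averaging over bands multiplies the data by phi_k / S. As [eta] already carries a factor phi_k in
   the measurement, it gets phi_k^2 / S, while [eps] gets phi_k / S. *)
pose a (i : ('I_M * 'I_K) + ('I_M * 'I_K)) := match i with
  | inl mk => u mk.1 * (phi mk.2 ^+ 2 / S)
  | inr mk => u mk.1 * (phi mk.2 / S) end.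
have law i : has_centered_normal_law (noise eta eps i) (s i).
  by case: i => -[m k]; [exact: law_eta|exact: law_eps].
have -> : (fun w => alpha_hat w - rho c) = (fun w =>
    (\sum_(m < M) u m * rho (z m) - rho c) + \sum_i a i * noise eta eps i w).
  apply/funext => w; have [beta [B wlsw]] := wls w.
  rewrite (wls_alpha_linear kappa_ge0 nd wlsw).
  rewrite addrAC; congr (_ - _).
  rewrite big_sumType /=.
  rewrite -(pair_bigA _ (fun m k => u m * (phi k ^+ 2 / S) * eta m k w)).
  rewrite -(pair_bigA _ (fun m k => u m * (phi k / S) * eps m k w)) /=.
  rewrite -!big_split /=.
  apply: eq_bigr => m _; rewrite -/(u m) -/S.
  transitivity (\sum_(k < K) (u m * (phi k ^+ 2 / S) * rho (z m) +
      u m * (phi k ^+ 2 / S) * eta m k w + u m * (phi k / S) * eps m k w)).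
    rewrite mulr_suml mulr_sumr; apply: eq_bigr => k _.
    by rewrite /measurement; ring.
  rewrite !big_split /= addrA; congr (_ + _ + _).
  (* The weights phi_k^2 / S sum to 1 over the bands, so the field contributes exactly u_m
     rho(z_m). *)
  by rewrite -mulr_suml -mulr_sumr -mulr_suml -/S divff// mulr1.
rewrite (variance_affine_normal _ _ law indep).
congr EFin; rewrite big_sumType /=.
rewrite -(pair_bigA _ (fun m k => (u m * (phi k ^+ 2 / S)) ^+ 2 * s_eta ^+ 2)).
rewrite -(pair_bigA _ (fun m k => (u m * (phi k / S)) ^+ 2 * s_eps ^+ 2)) /=.
rewrite -big_split mulr_sumr; apply: eq_bigr => m _ /=.
rewrite -/(u m); have SE : S = \sum_(k < K) phi k ^+ 2 by [].
move: (u m) S0 SE; clear; move: S => S um S0 SE.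
have -> : \sum_(k < K) (um * (phi k ^+ 2 / S)) ^+ 2 * s_eta ^+ 2 =
    um ^+ 2 * s_eta ^+ 2 / S ^+ 2 * \sum_(k < K) phi k ^+ 4.
  rewrite mulr_sumr; apply: eq_bigr => k _. by field.
(* The sum of the phi_k^2 is kept as [S], so that it cancels one of the two factors in the
   denominator and leaves 1 / S. *)
have -> : \sum_(k < K) (um * (phi k / S)) ^+ 2 * s_eps ^+ 2 =
    um ^+ 2 * s_eps ^+ 2 / S ^+ 2 * S.
  by rewrite [X in _ * X]SE mulr_sumr; apply: eq_bigr => k _; field.
by field.
Qed.
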